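(* Let $F$ be a forest with $|V(F)|\le 13$. Then $\chi_{\mathrm{g}}(F)\le 3$.
   Context: The $t$-coloring game on a finite graph $G$ with a set $C$ of $t$ colors: Alice and Bob alternate turns, Alice first, each coloring an uncolored vertex with a color from $C$ not used on any of its neighbors. Bob wins if at some point an uncolored vertex has no such color available; otherwise Alice wins when all vertices are colored. The game chromatic number $\chi_{\mathrm{g}}(G)$ is the least $t$ such that Alice has a winning strategy in the $t$-coloring game on the initially uncolored graph $G$. *)

(* Defs.v *)
From mathcomp Require Import all_boot.
Set Implicit Arguments. Unset Strict Implicit. Unset Printing Implicit Defensive.

Definition simple_graph (T : finType) (e : rel T) : Prop :=
  symmetric e /\ irreflexive e.

Definition is_cycle (T : finType) (e : rel T) (v : T) (p : seq T) : bool :=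
  [&& uniq (v :: p), 2 <= size p, path e v p & e (last v p) v].

Definition forest (T : finType) (e : rel T) : Prop :=
  simple_graph e /\ forall v p, ~~ is_cycle e v p.

Definition pcol (T : finType) (t : nat) := {ffun T -> option 'I_t}.

Definition legal (T : finType) (e : rel T) (t : nat) (c : pcol T t) (v : T) (k : 'I_t) : bool :=
  (c v == None) && [forall u, e v u ==> (c u != Some k)].

Definition bob_won (T : finType) (e : rel T) (t : nat) (c : pcol T t) : bool :=
  [exists v, (c v == None) && [forall k, ~~ legal e c v k]].

Definition full (T : finType) (t : nat) (c : pcol T t) : bool :=
  [forall v, c v != None].

Definition recolor (T : finType) (t : nat) (c : pcol T t) (v : T) (k : 'I_t) : pcol T t :=
  [ffun u => if u == v then Some k else c u].

(* alice_wins_from e t a c : from position c, with Alice to move iff a = true,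
   Alice has a winning strategy (least fixed point: finite game). *)
Inductive alice_wins_from (T : finType) (e : rel T) (t : nat) : bool -> pcol T t -> Prop :=
  | AW_full a c : full c -> alice_wins_from e a c
  | AW_alice c : ~~ bob_won e c -> ~~ full c ->
      (exists v k, legal e c v k /\ alice_wins_from e false (recolor c v k)) ->
      alice_wins_from e true c
  | AW_bob c : ~~ bob_won e c -> ~~ full c ->
      (forall v k, legal e c v k -> alice_wins_from e true (recolor c v k)) ->
      alice_wins_from e false c.

Definition alice_wins (T : finType) (e : rel T) (t : nat) : Prop :=
  @alice_wins_from T e t true [ffun _ => None].

(* chi_g(G) <= k, i.e. the least t for which Alice wins is at most k. *)
Definition game_chromatic_le (T : finType) (e : rel T) (k : nat) : Prop :=
  exists2 t, t <= k & alice_wins e t.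

(* Main.v *)
Require Import Defs.
From mathcomp Require Import all_boot.
From mathcomp Require Import zify.
Set Implicit Arguments. Unset Strict Implicit. Unset Printing Implicit Defensive.

(** Alice opens at a centroid [v], so that every component [W] of the forest
    minus [v] has at most 6 vertices and the sum of [deg x - 1] over [W] is at
    most 5. Only vertices of degree at least 3 can ever be blocked; by this count
    [W] contains at most two of them, and if they are adjacent with one of them
    adjacent to [v], then at most one unit of degree is left for the other
    vertices of [W]. Afterwards Alice answers inside the pair of dangerous
    vertices touched by Bob: she colors one of them so that the other one sees at
    most one color. The only obstruction is an adjacent pair whose two members
    both see the same single color; then she repeats that color on a leaf
    attached to one of the two, which thereby ceases to be dangerous. *)

(** * Duplicate-free lists inside a finite set *)

Lemma leq_sum_uniq (T : finType) (W : {set T}) (t : seq T) (f : T -> nat) :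
  uniq t -> {subset t <= W} -> \sum_(x <- t) f x <= \sum_(x in W) f x.
Proof.
move=> ut tW; rewrite big_uniq //= big_mkcond [leqRHS]big_mkcond /=.
by apply: leq_sum => x _; case: ifP => // /tW ->.
Qed.

Lemma subset_of_card_le (T : finType) (W : {set T}) (t : seq T) :
  uniq t -> {subset t <= W} -> #|W| <= size t -> {subset W <= t}.
Proof.
move=> ut tW leW x Wx; have [|||_ ->] := @uniq_min_size _ t (enum W) => //.
- by move=> y /tW; rewrite mem_enum.
- by rewrite -cardE.
- by rewrite mem_enum.
Qed.

(** * Forests *)

Section Forest.

Variables (T : finType) (e : rel T).
Hypothesis forest_e : forest e.

Definition nbrs x := [set y | e x y].

Let sym_e : symmetric e. Proof. by case: forest_e => -[]. Qed.
Let irr_e : irreflexive e. Proof. by case: forest_e => -[]. Qed.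
Let acyclic_e v p : ~~ is_cycle e v p. Proof. by case: forest_e. Qed.

Lemma adj_neq x y : e x y -> x != y.
Proof. by apply: contraTneq => ->; rewrite irr_e. Qed.

Lemma no_triangle x y z : e x y -> e y z -> e z x -> False.
Proof.
move=> xy yz zx; have /negP := acyclic_e x [:: y; z]; apply.
by rewrite /is_cycle /= !inE xy yz zx !negb_or !adj_neq // sym_e.
Qed.

Lemma common_nbr_uniq a b x y :
  a != b -> e x a -> e x b -> e y a -> e y b -> x = y.
Proof.
move=> ab xa xb ya yb; apply/eqP/negPn/negP => xy.
have /negP := acyclic_e x [:: a; y; b]; apply.
rewrite /is_cycle /= !inE xa (sym_e a) ya yb (sym_e b) xb !negb_or xy ab.
by rewrite !adj_neq // sym_e.
Qed.

(** If every vertex of [W] had two neighbors in [W], a path in [W] could always be prolonged at its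
    head: some neighbor differs from the next path vertex, and by acyclicity it is new. But no path
    outgrows [W]. *)
Lemma forest_leaf (W : {set T}) :
  W != set0 -> exists2 x, x \in W & #|nbrs x :&: W| <= 1.
Proof.
case/set0Pn=> x0 Wx0.
have [/exists_inP//|/exists_inPn noleaf] :=
  boolP [exists x in W, #|nbrs x :&: W| <= 1].
have long n : exists x p,
    [/\ uniq (x :: p), path e x p, {subset x :: p <= W} & size p = n].
  elim: n => [|n [x [p [up ep pW sp]]]].
    by exists x0, [::]; split=> // x; rewrite inE => /eqP->.
  have /noleaf := pW _ (mem_head _ _); rewrite -ltnNge => deg2.
  (* [head x p] is the path vertex following [x], or [x] itself when [p] is empty; the latter
     excludes no neighbor. *)
  have [y] : exists y, y \in (nbrs x :&: W) :\ head x p.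
    apply/set0Pn; rewrite -card_gt0; have := cardsD1 (head x p) (nbrs x :&: W).
    by case: (_ \in _) => /=; lia.
  rewrite !inE => /and3P[yp xy Wy]; exists y, (x :: p).
  have ypN : y \notin p.
    apply/negP=> py; case/splitPr: py up ep yp {pW sp} => [[|z p1] p2].
      by rewrite /= eqxx.
    move=> up ep _; have /negP := acyclic_e x (z :: rcons p1 y); apply.
    move: up ep; rewrite -cat_rcons cat_path -cat_cons cat_uniq.
    move=> /andP[up _] /andP[ep _].
    by rewrite /is_cycle up ep /= size_rcons last_rcons sym_e xy.
  split; [| by rewrite /= sym_e xy | | by rewrite /= sp].
    by rewrite /= inE negb_or ypN andbT (eq_sym y) adj_neq.
  by move=> w; rewrite in_cons; case/predU1P=> [->|/pW].
have [x [p [up _ pW sp]]] := long #|W|.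
suff: size (x :: p) <= size (enum W) by rewrite -cardE /= sp ltnn.
by apply: uniq_leq_size => // w /pW; rewrite mem_enum.
Qed.

(** Induction on [#|W|]: deleting a vertex with at most one neighbor in [W] removes at most one
    edge, hence at most 2 from the degree sum. *)
Lemma forest_degree_sum (W : {set T}) :
  W != set0 -> \sum_(x in W) #|nbrs x :&: W| <= (#|W|.-1).*2.
Proof.
have [n] := ubnP #|W|; elim: n W => // n IHn W /ltnSE leWn W0.
have [x Wx leaf] := forest_leaf W0.
have cW : #|W| = (#|W :\ x|).+1 by rewrite (cardsD1 x W) Wx.
rewrite (big_setD1 x) //= cW /=.
have -> : \sum_(y in W :\ x) #|nbrs y :&: W|
  = \sum_(y in W :\ x) (e y x + #|nbrs y :&: (W :\ x)|).
  by apply: eq_bigr => y _; rewrite (cardsD1 x) !inE Wx andbT setIDA.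
have [W1|W1] := eqVneq (W :\ x) set0.
  rewrite W1 cards0 big_set0 addn0 leqn0 cards_eq0 -subset0.
  apply/subsetP=> z; rewrite 2!inE => /andP[xz Wz].
  by rewrite -W1 !inE Wz eq_sym adj_neq.
rewrite big_split /=.
have {1}-> : \sum_(y in W :\ x) e y x = #|nbrs x :&: W|.
  rewrite -sum1_card big_mkcond [RHS]big_mkcond /=; apply: eq_bigr => y _.
  rewrite !inE sym_e; case: eqVneq => [->|_] /=; first by rewrite irr_e.
  by case: (y \in W); case: (e x y).
by have := IHn _ _ W1; rewrite -card_gt0 in W1; lia.
Qed.

(** * Components left after deleting a vertex *)

Definition adj_off v := [rel x y | [&& e x y, x != v & y != v]].
(* For [a != v], the component of [a] in the forest minus [v]; junk [[set v]] for [a = v]. *)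
Definition comp_off v a := [set y | connect (adj_off v) a y].

Lemma comp_off_refl v a : a \in comp_off v a.
Proof. by rewrite inE connect0. Qed.

Lemma connect_off_sym v : connect_sym (adj_off v).
Proof.
by apply: sym_connect_sym => x y /=; rewrite sym_e (andbC (x != v)).
Qed.

Lemma comp_off_neq v a x : a != v -> x \in comp_off v a -> x != v.
Proof.
move=> av; rewrite inE connect_off_sym => /connectP[[|y p] /=].
  by move=> _ <-.
by case/andP => /and3P[].
Qed.

Lemma comp_off_adj v a x y :
  a != v -> x \in comp_off v a -> e x y -> y != v -> y \in comp_off v a.
Proof.
move=> av Cx xy yv; have xv := comp_off_neq av Cx; move: Cx; rewrite !inE.
by move/connect_trans; apply; apply: connect1; rewrite /= xy xv.
Qed.

(** Two distinct neighbors of [v] joined by a path avoiding [v] would lie on a cycle through [v]. *)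
Lemma comp_off_nbr_uniq v a x y : a != v ->
  x \in comp_off v a -> y \in comp_off v a -> e v x -> e v y -> x = y.
Proof.
move=> av Cx Cy vx vy; have : connect (adj_off v) x y.
  by move: Cx Cy; rewrite !inE connect_off_sym; apply: connect_trans.
case/connectP=> p0 /shortenP[[|z p] ep up _ yE] //; rewrite {}yE in vy *.
have /negP[] := acyclic_e v (x :: z :: p).
have offp : {subset x :: z :: p <= predC1 v}.
  move=> u; rewrite in_cons; case/predU1P=> [->|]; first by rewrite !inE (comp_off_neq av Cx).
  elim: (z :: p) (x) ep => //= w q IH t /andP[/and3P[_ _ wv] eq].
  by rewrite in_cons; case/predU1P=> [->|]; [rewrite inE | apply: IH eq].
have ep' : path e x (z :: p) by apply: sub_path ep => s t /and3P[].
rewrite /is_cycle cons_uniq up [path _ _ _]/= vx -/(path e x (z :: p)) ep'.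
by rewrite sym_e vy !andbT; apply/negP=> /offp; rewrite inE /= eqxx.
Qed.

Lemma comp_off_sub v a (C : {set T}) : a != v ->
  a \in C -> (forall x y, x \in C -> e x y -> y != v -> y \in C) ->
  comp_off v a \subset C.
Proof.
move=> av Ca closedC; apply/subsetP=> y; rewrite inE => /connectP[p + ->].
elim: p a {av} Ca => //= z p IH a Ca /andP[/and3P[az _ zv]].
by apply: IH; apply: closedC az zv.
Qed.

(** As long as some component [C] at [v] has more than half of the vertices, move to a vertex [w] of
    [C]. Components at [w] that start in [C] stay in [C] and lose [w]; the others lie outside [C]
    and are smaller than [C]. So the bound on the component sizes drops. *)
Lemma centroid : T ->
  exists v, forall a, a != v -> (#|comp_off v a|).*2 <= #|T|.
Proof.
move=> v; have: forall a, a != v -> #|comp_off v a| <= #|T|.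
  by move=> a _; apply: max_card.
(* Only the bound on the component sizes becomes [n]; the [#|T|] of the conclusion stays. *)
move: {1}#|T| => n; elim: n v => [|n IHn] v lev.
  by exists v => a /lev; rewrite leqn0 cards_eq0 => /eqP->; rewrite cards0.
have [/forall_inP|] := boolP [forall (a | a != v), (#|comp_off v a|).*2 <= #|T|].
  by exists v.
rewrite negb_forall => /existsP[a]; rewrite negb_imply -ltnNge => /andP[av big].
set C := comp_off v a in big.
(* [w] is the neighbor of [v] in [C], or [a] if there is none. *)
have [w Cw wP] : exists2 w, w \in C & forall u, u \in C -> e v u -> u = w.
  have [/exists_inP[w Cw vw]|/exists_inPn nov] := boolP [exists w in C, e v w].
    by exists w => // u Cu vu; apply: (comp_off_nbr_uniq av Cu Cw).
  by exists a => [|u /nov /negPf->//]; apply: comp_off_refl.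
apply: (IHn w) => b bw; have leC : #|C| <= n.+1 := lev a av.
have [Cb|Cb] := boolP (b \in C).
  suff /subset_leq_card : comp_off w b \subset C :\ w.
    by have := cardsD1 w C; rewrite Cw; lia.
  apply: comp_off_sub => //; first by rewrite in_setD1 bw.
  move=> x y /setD1P[xw Cx] xy yw; rewrite in_setD1 yw /=.
  have [yv|yv] := eqVneq y v; last by have := comp_off_adj av Cx xy yv.
  by case/eqP: xw; apply: wP => //; rewrite sym_e -yv.
suff /subset_leq_card : comp_off w b \subset ~: C.
  by have := cardsC C; lia.
apply: comp_off_sub => //; first by rewrite in_setC.
move=> x y; rewrite !in_setC => Cx xy yw; apply: contra Cx => Cy.
have [xv|xv] := eqVneq x v; last by apply: comp_off_adj Cy _ xv; rewrite // sym_e.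
by case/eqP: yw; apply: wP => //; rewrite -xv.
Qed.

(** At most one edge joins the component to [v], so its degrees sum to at most twice its size minus
    1. As [a] is not isolated, no vertex of the component is, and the predecessors are never
    truncated. *)
Lemma comp_off_excess v a : a != v -> nbrs a != set0 ->
  \sum_(x in comp_off v a) (#|nbrs x|).-1 <= (#|comp_off v a|).-1.
Proof.
move=> av a0; set W := comp_off v a.
have vW : v \notin W by apply: contraTN (eqxx v) => /comp_off_neq; apply.
have Wgt0 : 0 < #|W| by apply/card_gt0P; exists a; apply: comp_off_refl.
have degW x : x \in W -> 0 < #|nbrs x|.
  rewrite card_gt0 inE connect_off_sym => /connectP[[|y p] /=].
    by move=> _ <-.
  by case/andP => /and3P[xy _ _] _ _; apply/set0Pn; exists y; rewrite inE.
suff deg_sum : \sum_(x in W) #|nbrs x| <= #|W|.*2.-1.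
  have : \sum_(x in W) #|nbrs x| = \sum_(x in W) (#|nbrs x|).-1 + #|W|.
    rewrite -sum1_card -big_split; apply: eq_bigr => x /degW /=; lia.
  lia.
have [/exists_inP[w Ww vw]|/exists_inPn nov] := boolP [exists w in W, e v w].
  (* The degree bound is applied to [v |: W], where [v] itself uses up at least 1 of the total. *)
  have : v |: W != set0 by apply/set0Pn; exists v; rewrite setU11.
  move/forest_degree_sum; rewrite (big_setD1 v) ?setU11 //= setU1K //.
  rewrite cardsU1 vW add1n /=.
  have : 0 < #|nbrs v :&: (v |: W)|.
    by apply/card_gt0P; exists w; rewrite in_setI in_setU1 Ww orbT inE vw.
  suff -> : \sum_(x in W) #|nbrs x :&: (v |: W)| = \sum_(x in W) #|nbrs x| by lia.
  apply: eq_bigr => x Wx; rewrite (setIidPl _) //; apply/subsetP=> y.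
  rewrite in_setU1 inE => xy; case: eqVneq => //= yv.
  exact: comp_off_adj xy yv.
have /forest_degree_sum : W != set0 by rewrite -card_gt0.
suff -> : \sum_(x in W) #|nbrs x :&: W| = \sum_(x in W) #|nbrs x| by lia.
apply: eq_bigr => x Wx; rewrite (setIidPl _) //; apply/subsetP=> y.
rewrite inE => xy; apply: comp_off_adj (xy) _ => //.
by apply: contraTneq xy => ->; rewrite sym_e; apply: nov.
Qed.

End Forest.

(** * Secure positions *)

Section Game.

Variables (T : finType) (e : rel T).
Hypothesis forest_e : forest e.
Implicit Types (c : pcol T 3) (a b r s u v w x y z : T) (k l : 'I_3).

Let sym_e : symmetric e. Proof. by case: forest_e => -[]. Qed.
Let irr_e : irreflexive e. Proof. by case: forest_e => -[]. Qed.

Definition cols c v := [set k | [exists u, e v u && (c u == Some k)]].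
Definition unc c v := [set u in nbrs e v | c u == None].
(* A vertex that is not dangerous keeps an available color whatever is played. *)
Definition dangerous c v := (c v == None) && (2 < #|cols c v| + #|unc c v|).
(** One move can affect both members of such a pair: a common uncolored neighbor shows them the same
    color, and coloring one of two adjacent vertices changes what the other sees. *)
Definition linked c a b :=
  (a != b) && (e a b || [exists y, [&& c y == None, e y a & e y b]]).

(* For adjacent dangerous [s] and [r] where only [s] sees a color: if Bob makes
   [r] see the same color, then Alice neutralizes [s] (first case) or [r]
   (second case) by playing that color again on a leaf. *)
Inductive repairable c s r : Prop :=
| RepairSeeing v y of c v != None & c y = None & e s y
    & {subset nbrs e s <= [:: v; r; y]} & nbrs e y = [set s]
| RepairBlank p q of p != q & c p = None & c q = None & e r p & e r q
    & {subset nbrs e r <= [:: s; p; q]} & nbrs e p = [set r] & nbrs e q = [set r].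

(** The invariant with Bob to move. Links form a partial matching of the dangerous vertices; since
    the dangerous neighbors of an uncolored vertex are mutually linked, a move of Bob touches at
    most one pair. *)
Record secure c : Prop := Secure {
  secure_cols : forall a, dangerous c a -> #|cols c a| <= 1;
  secure_matching : forall a b b', dangerous c a -> dangerous c b ->
    dangerous c b' -> linked c a b -> linked c a b' -> b = b';
  secure_blank : forall a b, dangerous c a -> dangerous c b -> linked c a b ->
    (cols c a == set0) || (cols c b == set0);
  secure_repair : forall s r, dangerous c s -> dangerous c r -> e s r ->
    cols c s != set0 -> repairable c s r }.

Lemma linked_sym c a b : linked c a b = linked c b a.
Proof.
rewrite /linked eq_sym sym_e; congr (_ && (_ || _)).
by apply: eq_existsb => y; rewrite [e y a && _]andbC.
Qed.

Lemma linked_adj c a b : e a b -> linked c a b.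
Proof. by move=> ab; rewrite /linked ab (adj_neq forest_e ab). Qed.

Lemma linked_common c y a b : c y = None -> a != b -> e y a -> e y b -> linked c a b.
Proof.
move=> cy ab ya yb; rewrite /linked ab; apply/orP; right.
by apply/existsP; exists y; rewrite cy eqxx ya.
Qed.

Lemma legalE c v k : legal e c v k = (c v == None) && (k \notin cols c v).
Proof.
rewrite /legal inE negb_exists; congr (_ && _); apply: eq_forallb => u.
by rewrite implybE negb_and.
Qed.

Lemma legal_exists c v : c v = None -> #|cols c v| <= 2 -> exists k, legal e c v k.
Proof.
move=> cv le2; have /card_gt0P[k] : 0 < #|~: cols c v|.
  by have := cardsC (cols c v); rewrite card_ord; lia.
by rewrite inE => kv; exists k; rewrite legalE cv eqxx.
Qed.

Lemma cols_blank v : cols [ffun _ => None] v = set0.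
Proof.
by apply/setP=> k; rewrite !inE; apply/existsP=> -[w]; rewrite ffunE andbF.
Qed.

(** * Effect of a single move *)

Section Recolor.

Variables (c : pcol T 3) (x : T) (l : 'I_3).
Hypothesis cx : c x = None.
Let c' := recolor c x l.

Lemma recolorE u : c' u = if u == x then Some l else c u.
Proof. by rewrite ffunE. Qed.

Lemma recolor_None u : c' u = None -> c u = None.
Proof. by rewrite recolorE; case: eqP. Qed.

Lemma recolor_Some u : c u != None -> c' u != None.
Proof. by rewrite recolorE; case: ifP. Qed.

Lemma recolor_other u : u != x -> c' u = c u.
Proof. by rewrite recolorE => /negPf->. Qed.

Lemma cols_recolor u : cols c' u = if e u x then l |: cols c u else cols c u.
Proof.
apply/setP=> k; rewrite inE; apply/existsP/idP => [[w]|].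
  rewrite recolorE; case: (eqVneq w x) => [->|_] /andP[uw].
    by rewrite uw => /eqP[->]; rewrite setU11.
  move=> cw; suff ku : k \in cols c u by case: ifP; rewrite // in_setU1 ku orbT.
  by rewrite inE; apply/existsP; exists w; rewrite uw.
have cwk : k \in cols c u -> exists w, e u w && (c' w == Some k).
  rewrite inE => /existsP[w /andP[uw cw]]; exists w.
  by rewrite recolorE uw; case: (eqVneq w x) cw => // ->; rewrite cx.
by case: ifP => ux //; case/setU1P => // ->; exists x; rewrite ux recolorE !eqxx.
Qed.

Lemma cols_recolor_off u : ~~ e u x -> cols c' u = cols c u.
Proof. by rewrite cols_recolor => /negPf->. Qed.

Lemma cols_recolor_le u : #|cols c' u| <= #|cols c u|.+1.
Proof. by rewrite cols_recolor; case: ifP => // _; rewrite cardsU1; lia. Qed.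

Lemma unc_recolor u : unc c' u = unc c u :\ x.
Proof.
apply/setP=> y; rewrite !inE recolorE.
by case: (eqVneq y x) => //= ->; rewrite andbF.
Qed.

(** A move next to [u] removes an uncolored neighbor and adds at most one seen color, so the sum in
    [dangerous] never grows: danger never arises anew. *)
Lemma dangerous_recolor u : dangerous c' u -> dangerous c u.
Proof.
rewrite /dangerous => /andP[/eqP/recolor_None->]; rewrite eqxx /=.
rewrite unc_recolor cols_recolor (cardsD1 x (unc c u)) !inE cx eqxx andbT.
by case: ifP => _; rewrite ?cardsU1 /=; lia.
Qed.

Lemma dangerous_neq u : dangerous c' u -> u != x.
Proof. by rewrite /dangerous recolorE; case: (eqVneq u x). Qed.

Lemma linked_recolor a b : linked c' a b -> linked c a b.
Proof.
case/andP=> ab /orP[/linked_adj->//|/existsP[y /and3P[/eqP/recolor_None cy ya yb]]].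
exact: linked_common cy ab ya yb.
Qed.

Lemma repairable_recolor s r :
  ~~ e s x -> ~~ e r x -> repairable c s r -> repairable c' s r.
Proof.
move=> sx rx [v y cv cy sy Ns Ny|p q pq cp cq rp rq Nr Np Nq].
  apply: (RepairSeeing (v := v) (y := y)) => //; first exact: recolor_Some.
  by rewrite recolor_other //; apply: contraNneq sx => <-.
by apply: (RepairBlank (p := p) (q := q)) => //; rewrite recolor_other //;
   apply: contraNneq rx => <-.
Qed.

End Recolor.

(** * Alice's replies in a secure position *)

Lemma not_bob_won c : (forall a, dangerous c a -> #|cols c a| <= 2) -> ~~ bob_won e c.
Proof.
move=> le2; apply/existsP=> -[v /andP[/eqP cv /forallP blocked]].
have [|k] := legal_exists cv; last by apply/negP/blocked.
have [/le2//|] := boolP (dangerous c v).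
by rewrite /dangerous cv eqxx /= -leqNgt; lia.
Qed.

(* [P] contains, with every vertex endangered by the last two moves, all its
   partners, and these moves leave no danger in [P]. *)
Lemma secure_after_reply c x l z k (P : pred T) :
  let c1 := recolor c x l in let c2 := recolor c1 z k in
  secure c -> c x = None -> c1 z = None ->
  (forall u w, dangerous c2 u -> dangerous c2 w -> linked c u w -> P w -> P u) ->
  (forall u, dangerous c2 u -> e u x || e u z -> P u) ->
  (forall u, P u -> dangerous c2 u -> #|cols c2 u| <= 1) ->
  (forall u w, P u -> P w -> dangerous c2 u -> dangerous c2 w -> ~~ linked c2 u w) ->
  secure c2.
Proof.
move=> c1 c2 [sec_cols match_c blank repair] cx cz closedP nearP colP unlP.
have dang u : dangerous c2 u -> dangerous c u.
  by move/(dangerous_recolor cz)/(dangerous_recolor cx).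
have lnk u w : linked c2 u w -> linked c u w.
  by move/(@linked_recolor c1)/(@linked_recolor c).
have far u : dangerous c2 u -> ~~ P u -> [/\ ~~ e u x, ~~ e u z & cols c2 u = cols c u].
  move=> du; move/(contra (nearP u du)); rewrite negb_or => /andP[ux uz].
  by rewrite !cols_recolor_off.
(* [P] is closed under links and contains no linked pair after the reply, so linked pairs lie
   outside [P], where the seen colors are unchanged. *)
have outP u w : dangerous c2 u -> dangerous c2 w -> linked c2 u w -> ~~ P u /\ ~~ P w.
  move=> du dw luw; suff Puw : P u = P w.
    by rewrite Puw; suff: ~~ P w by []; apply: contraL luw => Pw; apply: unlP; rewrite ?Puw.
  by apply/idP/idP; apply: closedP => //; [rewrite linked_sym|]; apply: lnk.
split.
- move=> u du; have [/colP->//|Pu] := boolP (P u).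
  by have [_ _ ->] := far u du Pu; apply/sec_cols/dang.
- move=> a b b' da db db' /lnk lab /lnk; apply: match_c lab => //; exact: dang.
- move=> a b da db lab; have [Pa Pb] := outP a b da db lab.
  have [_ _ ->] := far a da Pa; have [_ _ ->] := far b db Pb.
  by apply: blank; [apply: dang | apply: dang | apply: lnk].
- move=> s r ds dr sr; have [Ps Pr] := outP s r ds dr (linked_adj c2 sr).
  have [sx sz ->] := far s ds Ps; have [rx rz _] := far r dr Pr => cs.
  by do 2![apply: repairable_recolor => //]; apply: repair => //; apply: dang.
Qed.

(** By the matching, [s] and [r] have no other partners, so the pair itself serves as [P]; only [r]
    can still be dangerous. *)
Lemma secure_pair_reply c x l z k s r :
  let c1 := recolor c x l in let c2 := recolor c1 z k in
  secure c -> c x = None -> c1 z = None ->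
  dangerous c1 s -> dangerous c1 r -> linked c s r ->
  (forall u, dangerous c1 u -> e u x -> u \in [:: s; r]) ->
  (forall u, dangerous c1 u -> e u z -> u \in [:: s; r]) ->
  ~~ dangerous c2 s -> #|cols c2 r| <= 1 -> secure c2.
Proof.
move=> c1 c2 sec cx cz ds dr lsr nearx nearz ds2 cr2.
have dang1 u : dangerous c2 u -> dangerous c1 u by apply: dangerous_recolor.
have dang u : dangerous c1 u -> dangerous c u by apply: dangerous_recolor.
have onlyr u : u \in [:: s; r] -> dangerous c2 u -> u = r.
  by rewrite !inE => /orP[]/eqP-> // du; rewrite du in ds2.
apply: (@secure_after_reply _ _ _ _ _ (fun u => u \in [:: s; r])) => //.
- move=> u w /dang1/dang du /dang1/dang dw luw; rewrite !inE.
  case/orP=> /eqP wE; rewrite {}wE linked_sym in luw.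
    by rewrite (secure_matching sec (dang _ ds) (dang _ dr) du lsr luw) eqxx orbT.
  rewrite linked_sym in lsr.
  by rewrite (secure_matching sec (dang _ dr) (dang _ ds) du lsr luw) eqxx.
- by move=> u /dang1 du /orP[]; [apply: nearx | apply: nearz].
- by move=> u Pu /(onlyr u Pu) ->.
- move=> u w Pu Pw /(onlyr u Pu) -> /(onlyr w Pw) ->.
  by rewrite /linked eqxx.
Qed.

Lemma secure_color_reply c x l k s r :
  let c1 := recolor c x l in let c2 := recolor c1 s k in
  secure c -> c x = None -> dangerous c1 s -> dangerous c1 r -> linked c s r ->
  (forall u, dangerous c1 u -> e u x -> u \in [:: s; r]) ->
  #|cols c2 r| <= 1 -> secure c2.
Proof.
move=> c1 c2 sec cx ds dr lsr nearx cr2.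
apply: (secure_pair_reply (s := s) (r := r)) => //.
- by case/andP: ds => /eqP.
- move=> u du us; rewrite sym_e in us.
  have dang w : dangerous c1 w -> dangerous c w by apply: dangerous_recolor.
  rewrite (secure_matching sec (dang _ ds) (dang _ dr) (dang _ du) lsr) ?inE ?eqxx ?orbT //.
  exact: linked_adj.
- by apply/negP=> /dangerous_neq; rewrite eqxx.
Qed.

(** Repeating [l] on the leaf [y] shows [s] no new color and leaves it at most the uncolored
    neighbor [r]: the sum for [s] is at most 2. The move is legal because the only neighbor of [y]
    is the uncolored [s]. *)
Lemma secure_leaf_reply c x l y s r :
  let c1 := recolor c x l in
  secure c -> c x = None -> dangerous c1 s -> dangerous c1 r -> e s r ->
  (forall u, dangerous c1 u -> e u x -> u \in [:: s; r]) ->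
  c1 y = None -> e s y -> nbrs e y = [set s] ->
  (forall w, e s w -> c1 w = None -> w \in [:: r; y]) ->
  cols c1 s = [set l] -> #|cols c1 r| <= 1 ->
  exists z k, legal e c1 z k /\ secure (recolor c1 z k).
Proof.
move=> c1 sec cx ds dr sr nearx cy sy Ny Ns cs cr.
have yP w : e y w -> w = s by move=> yw; apply/set1P; rewrite -Ny inE.
have [cs0 _] := andP ds.
exists y, l; split.
  rewrite legalE cy eqxx inE; apply/existsP=> -[w /andP[/yP-> cl]].
  by rewrite (eqP cs0) in cl.
apply: (secure_pair_reply (s := s) (r := r)) => //.
- exact: linked_adj.
- by move=> u _; rewrite sym_e => /yP->; rewrite mem_head.
- rewrite /dangerous negb_and -leqNgt cols_recolor // sy cs setUid cards1.
  apply/orP; right; rewrite add1n ltnS.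
  apply: (@leq_trans #|[set r]|); last by rewrite cards1.
  apply/subset_leq_card/subsetP=> w; rewrite unc_recolor // !inE.
  by case/and3P=> wy sw /eqP cw; have := Ns w sw cw; rewrite !inE (negPf wy) orbF.
- rewrite cols_recolor_off //; apply/negP; rewrite sym_e => /yP rs.
  by rewrite rs irr_e in sr.
Qed.

(** Color [s] if the pair is not adjacent; if it is and one member still sees nothing, color the
    other. Otherwise Bob has just shown [l] to [r], while [s] sees a single color, and the answer
    depends on whether that color is [l]. *)
Lemma secure_reply_blank c x l s r :
  let c1 := recolor c x l in
  secure c -> c x = None -> dangerous c1 s -> dangerous c1 r -> linked c s r ->
  (forall u, dangerous c1 u -> e u x -> u \in [:: s; r]) ->
  cols c r = set0 -> exists z k, legal e c1 z k /\ secure (recolor c1 z k).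
Proof.
move=> c1 sec cx ds dr lsr nearx blank.
have dang u : dangerous c1 u -> dangerous c u by apply: dangerous_recolor.
have c1s : c1 s = None by case/andP: (ds) => /eqP.
have c1r : c1 r = None by case/andP: (dr) => /eqP.
have le1 u : dangerous c1 u -> #|cols c u| <= 1 by move/dang/(secure_cols sec).
have lrs : linked c r s by rewrite linked_sym.
have nearx' u : dangerous c1 u -> e u x -> u \in [:: r; s].
  by move=> du /(nearx u du); rewrite !inE orbC.
have legal1 u : dangerous c1 u -> exists k, legal e c1 u k.
  move=> du; apply: legal_exists; first by case/andP: du => /eqP.
  by apply: leq_trans (cols_recolor_le l cx u) _; apply: le1.
have [k ksP] := legal1 s ds.
have [sr|sr] := boolP (e s r); last first.
  exists s, k; split=> //; apply: (secure_color_reply (r := r)) => //.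
  rewrite cols_recolor_off //; last by rewrite sym_e.
  by apply: leq_trans (cols_recolor_le l cx r) _; rewrite blank cards0.
have [r0|r0] := eqVneq (cols c1 r) set0.
  exists s, k; split=> //; apply: (secure_color_reply (r := r)) => //.
  by apply: leq_trans (cols_recolor_le k c1s r) _; rewrite r0 cards0.
have [s0|s0] := eqVneq (cols c1 s) set0.
  have [k' krP] := legal1 r dr.
  exists r, k'; split=> //; apply: (secure_color_reply (r := s)) => //.
  by apply: leq_trans (cols_recolor_le k' c1r s) _; rewrite s0 cards0.
have rx : e r x by apply: contraNT r0 => rx; rewrite cols_recolor_off // blank.
have sx : ~~ e s x.
  by apply/negP=> sx; apply: (no_triangle forest_e sr rx); rewrite sym_e.
have c1rE : cols c1 r = [set l] by rewrite cols_recolor // rx blank setU0.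
have c1sE : cols c1 s = cols c s by rewrite cols_recolor_off.
have /cards1P[l' sl'] : #|cols c1 s| == 1.
  by rewrite eqn_leq card_gt0 s0 c1sE le1.
(* If the colors differ, [l'] is legal on [r] and [s] already sees it. *)
have [ll'|ll'] := eqVneq l' l; last first.
  exists r, l'; split; first by rewrite legalE c1r eqxx c1rE inE.
  apply: (secure_color_reply (r := s)) => //.
  by rewrite cols_recolor // sr sl' setUid cards1.
rewrite {}ll' in sl'.
have xP w : e s w -> w != x by apply: contraTneq => ->.
have [|v y cv cy sy Ns Ny|p q pq cp cq rp rq Nr Np Nq] :=
  secure_repair sec (dang _ ds) (dang _ dr) sr.
- by rewrite -c1sE.
- apply: (secure_leaf_reply (y := y) (s := s) (r := r)) => //.
  + by rewrite /c1 recolor_other ?xP.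
  + move=> w sw cw; have := Ns w; rewrite inE sw !inE => /(_ isT)/or3P[]/eqP wE.
    * by move: cw; rewrite wE => /recolor_None cv0; rewrite cv0 in cv.
    * by rewrite wE eqxx.
    * by rewrite wE eqxx orbT.
  + by rewrite c1rE cards1.
have rs : e r s by rewrite sym_e.
(* Bob's vertex [x] is a neighbor of [r] other than [s], so it is one of the two leaves; Alice will
   answer on the other. *)
wlog xp : p q pq cp cq rp rq Nr Np Nq / x = p.
  move=> IH; have := Nr x; rewrite !inE rx => /(_ isT)/or3P[]/eqP.
  - by move=> xs; have := dangerous_neq ds; rewrite xs eqxx.
  - exact: (IH p q).
  - apply: (IH q p) => //; first by rewrite eq_sym.
    by move=> w /Nr; rewrite !inE (orbC (w == q)).
apply: (secure_leaf_reply (y := q) (s := r) (r := s)) => //.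
- by rewrite /c1 recolor_other // xp eq_sym.
- move=> w rw; have := Nr w; rewrite inE rw !inE => /(_ isT)/or3P[]/eqP->.
  + by rewrite eqxx.
  + by rewrite -xp recolorE eqxx.
  + by rewrite eqxx orbT.
- by rewrite sl' cards1.
Qed.

(** If a dangerous neighbor of [x] exists, it is taken as [a]: the others share [x] with it and were
    linked to it. If [a] has a dangerous partner, the blank member of the pair plays the role of
    [r]; otherwise Alice colors [a]. *)
Lemma secure_reply c x l a :
  let c1 := recolor c x l in
  secure c -> c x = None -> dangerous c1 a ->
  exists z k, legal e c1 z k /\ secure (recolor c1 z k).
Proof.
move=> c1 sec cx da0.
have dang u : dangerous c1 u -> dangerous c u by apply: dangerous_recolor.
have {a da0} [a da nearx] : exists2 a, dangerous c1 a &
    forall u, dangerous c1 u -> e u x -> u = a \/ linked c a u.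
  have [/existsP[b /andP[db bx]]|/existsPn none] :=
    boolP [exists b, dangerous c1 b && e b x].
    exists b => // u du ux; have [->|ub] := eqVneq u b; [by left | right].
    by apply: (linked_common cx); rewrite 1?eq_sym // sym_e.
  by exists a => // u du ux; have := none u; rewrite du ux.
have [/existsP[b /andP[db lab]]|/existsPn none] :=
  boolP [exists b, dangerous c1 b && linked c a b].
  have nearab u : dangerous c1 u -> e u x -> u \in [:: a; b].
    move=> du /(nearx u du)[->|lau]; first by rewrite mem_head.
    by rewrite (secure_matching sec (dang a da) (dang b db) (dang u du) lab lau) !inE eqxx orbT.
  have /orP[/eqP a0|/eqP b0] := secure_blank sec (dang a da) (dang b db) lab.
    apply: (secure_reply_blank (s := b) (r := a)) => //; first by rewrite linked_sym.
    by move=> u du /(nearab u du); rewrite !inE orbC.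
  exact: (secure_reply_blank (s := a) (r := b)).
have c1a : c1 a = None by case/andP: (da) => /eqP.
have [|k ka] := legal_exists c1a.
  by apply: leq_trans (cols_recolor_le l cx a) _; apply/(secure_cols sec)/dang.
have alone u : dangerous c1 u -> linked c a u -> false.
  by move=> du lau; have := none u; rewrite du lau.
have dang1 u : dangerous (recolor c1 a k) u -> dangerous c1 u.
  exact: dangerous_recolor.
exists a, k; split=> //; apply: (@secure_after_reply _ _ _ _ _ (pred1 a)) => //.
- by move=> u w /dang1 du _ luw /eqP wa; have := alone u du; rewrite linked_sym -wa => /(_ luw).
- move=> u /dang1 du /orP[/(nearx u du)[->|/(alone u du)//]|ua]; first exact: eqxx.
  by rewrite sym_e in ua; have := alone u du (linked_adj c ua).
- by move=> u /eqP-> /dangerous_neq; rewrite eqxx.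
- by move=> u w /eqP-> _ /dangerous_neq; rewrite eqxx.
Qed.

(** Induction on the number of uncolored vertices. Bob's move leaves every dangerous vertex at most
    2 seen colors, so nothing is blocked. Once no vertex is dangerous, any legal move of Alice keeps
    security vacuously. *)
Lemma secure_alice_wins c : secure c -> alice_wins_from e false c.
Proof.
have [n] := ubnP #|[set v | c v == None]|; elim: n c => // n IHn c lt_n sec.
have [fc|nfc] := boolP (full c); first exact: AW_full.
apply: AW_bob => //.
  by apply: not_bob_won => a /(secure_cols sec) /leq_trans; apply.
move=> x l; rewrite legalE => /andP[/eqP cx _].
set c1 := recolor c x l.
have [fc1|nfc1] := boolP (full c1); first exact: AW_full.
have unb : ~~ bob_won e c1.
  apply: not_bob_won => a /(dangerous_recolor cx)/(secure_cols sec) ca.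
  exact: leq_trans (cols_recolor_le l cx a) _.
apply: AW_alice => //.
have [z [k [zk sec2]]] : exists z k, legal e c1 z k /\ secure (recolor c1 z k).
  have [/existsP[a]|/existsPn safe] := boolP [exists a, dangerous c1 a].
    exact: secure_reply.
  move: nfc1; rewrite negb_forall => /existsP[z]; rewrite negbK => /eqP c1z.
  have [|k zk] := legal_exists c1z.
    by have := safe z; rewrite /dangerous c1z eqxx -leqNgt /=; lia.
  exists z, k; split=> //.
  have safe2 u : dangerous (recolor c1 z k) u -> False.
    by move/(dangerous_recolor c1z); apply/negP.
  by split=> [a /safe2|a b b' /safe2|a b /safe2|s r /safe2].
exists z, k; split=> //; apply: IHn => //.
have /eqP c1z : c1 z == None by case/andP: zk.
rewrite -ltnS; apply: leq_trans lt_n; rewrite ltnS; apply: proper_card.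
apply/properP; split.
  by apply/subsetP=> u; rewrite !inE => /eqP/recolor_None/recolor_None->.
by exists x; rewrite !inE ?cx // !recolorE eqxx; case: ifP.
Qed.

End Game.

(** * The opening move *)

Section Opening.

Variables (T : finType) (e : rel T) (v : T) (k : 'I_3).
Hypotheses (forest_e : forest e)
  (small : forall a, a != v -> #|comp_off e v a| <= 6).

Let c0 : pcol T 3 := [ffun _ => None].
Let c := recolor c0 v k.
Let c0v : c0 v = None. Proof. by rewrite ffunE. Qed.
Let sym_e : symmetric e. Proof. by case: forest_e => -[]. Qed.

Lemma opening_dangerous u : dangerous e c u -> (u != v) * (2 < #|nbrs e u|).
Proof.
move=> du; split; first exact: dangerous_neq du.
have /andP[_] := dangerous_recolor c0v du.
rewrite cols_blank cards0 add0n => /leq_trans; apply; apply/subset_leq_card/subsetP => y.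
by rewrite !inE => /andP[].
Qed.

Lemma opening_cols u : cols e c u = if e u v then [set k] else set0.
Proof. by rewrite cols_recolor // cols_blank setU0. Qed.

Lemma opening_linked a b : a != v -> b != v -> linked e c a b -> b \in comp_off e v a.
Proof.
move=> av bv /andP[_ /orP[ab|/existsP[y /and3P[cy ya yb]]]].
  exact: (comp_off_adj forest_e av (comp_off_refl e v a) ab bv).
have yv : y != v by apply: contraTneq cy => ->; rewrite recolorE eqxx.
apply: (comp_off_adj forest_e av _ yb bv).
by apply: (comp_off_adj forest_e av (comp_off_refl e v a) _ yv); rewrite sym_e.
Qed.

(** The 5 is the maximal component size 6 minus 1. *)
Lemma opening_excess a t : a != v -> nbrs e a != set0 ->
  uniq t -> {subset t <= comp_off e v a} -> \sum_(x <- t) (#|nbrs e x|).-1 <= 5.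
Proof.
move=> av Na ut tW; apply: leq_trans (leq_sum_uniq _ ut tW) _.
apply: leq_trans (comp_off_excess forest_e av Na) _.
by have := small av; lia.
Qed.

(** With [y] a third neighbor of [s], and [p], [q] two neighbors of [r] besides [s], failure of the
    first repair costs an extra unit of degree at [s] or [y], and failure of the second one at [r],
    [p] or [q]. With 2 each for [s] and [r] this makes 6, above the allowed 5. *)
Lemma opening_repairable s r :
  dangerous e c s -> dangerous e c r -> e s r -> e s v -> repairable e c s r.
Proof.
move=> /opening_dangerous[sv degs] /opening_dangerous[rv degr] sr esv.
have Ns0 : nbrs e s != set0 by rewrite -card_gt0; lia.
have nrv : ~~ e r v.
  by apply/negP=> erv; apply: (no_triangle forest_e sr erv); rewrite sym_e.
have rs : e r s by rewrite sym_e.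
have [y] : exists y, y \in nbrs e s :\ v :\ r.
  apply/card_gt0P; have := cardsD1 v (nbrs e s).
  by have := cardsD1 r (nbrs e s :\ v); rewrite !inE sr esv rv /=; lia.
rewrite !inE => /and3P[yr yv sy].
have [p [q []]] : exists p q, [/\ p \in nbrs e r :\ s, q \in nbrs e r :\ s & p != q].
  by apply/card_gt1P; have := cardsD1 s (nbrs e r); rewrite !inE rs /=; lia.
rewrite !inE => /andP[ps rp] /andP[qs rq] pq.
have notv w : e r w -> w != v by apply: contraTneq => ->.
have noty w : e r w -> y != w.
  move=> rw; apply/eqP=> yw; apply: (no_triangle forest_e sr rw).
  by rewrite -yw sym_e.
have cN w : w != v -> c w = None by move=> wv; rewrite /c recolor_other // ffunE.
have leaf u w : e u w -> #|nbrs e w| <= 1 -> nbrs e w = [set u].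
  move=> uw lew; apply/esym/eqP; rewrite eqEcard cards1 lew andbT sub1set inE.
  by rewrite sym_e.
have degree_gt0 u w : e u w -> 0 < #|nbrs e w|.
  by move=> uw; apply/card_gt0P; exists u; rewrite inE sym_e.
have [/andP[les ley]|nseeing] := boolP ((#|nbrs e s| <= 3) && (#|nbrs e y| <= 1)).
  apply: (RepairSeeing (v := v) (y := y)) => //.
  - by rewrite recolorE eqxx.
  - exact: cN.
  - apply: subset_of_card_le => //=.
      by rewrite !inE negb_or (eq_sym v r) rv (eq_sym v) yv eq_sym yr.
    by move=> w; rewrite !inE => /or3P[]/eqP->.
  - exact: leaf.
have [/and3P[ler lep leq]|nblank] :=
    boolP [&& #|nbrs e r| <= 3, #|nbrs e p| <= 1 & #|nbrs e q| <= 1].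
  apply: (RepairBlank (p := p) (q := q)) => //; try exact: leaf.
  - by rewrite cN ?notv.
  - by rewrite cN ?notv.
  - apply: subset_of_card_le => //=.
      by rewrite !inE negb_or (eq_sym s) ps (eq_sym s) qs pq.
    by move=> w; rewrite !inE => /or3P[]/eqP->.
have Ws : s \in comp_off e v s by apply: comp_off_refl.
have Wr : r \in comp_off e v s := comp_off_adj forest_e sv Ws sr rv.
have := @opening_excess s [:: s; r; y; p; q] sv Ns0.
have -> : uniq [:: s; r; y; p; q].
  rewrite /= !inE !negb_or pq (adj_neq forest_e sr) (adj_neq forest_e sy).
  rewrite (eq_sym s) ps (eq_sym s) qs (eq_sym r) yr.
  by rewrite (adj_neq forest_e rp) (adj_neq forest_e rq) !noty.
have sub : {subset [:: s; r; y; p; q] <= comp_off e v s}.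
  move=> w; rewrite !in_cons in_nil orbF; case/or4P=> [||| /orP[]] /eqP-> //.
  - exact: comp_off_adj sy yv.
  - by apply: (comp_off_adj forest_e sv Wr rp); apply: notv.
  - by apply: (comp_off_adj forest_e sv Wr rq); apply: notv.
move=> /(_ isT sub); rewrite !big_cons big_nil.
have := degree_gt0 _ _ sy; have := degree_gt0 _ _ rp; have := degree_gt0 _ _ rq.
move: degs degr nseeing nblank; rewrite !negb_and -!ltnNge.
move: #|nbrs e s| #|nbrs e r| #|nbrs e y| #|nbrs e p| #|nbrs e q|.
by clear; case=> [|ds] [|dr] [|dy] [|dp] [|dq] //=; lia.
Qed.

Lemma opening_secure : secure e c.
Proof.
split.
- by move=> a _; rewrite opening_cols; case: ifP => _; rewrite ?cards1 ?cards0.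
- move=> a b b' /opening_dangerous[av da] /opening_dangerous[bv db].
  move=> /opening_dangerous[b'v db'] lab lab'; apply/eqP/negPn/negP => bb'.
  have Na : nbrs e a != set0 by rewrite -card_gt0; lia.
  (* Three vertices of degree at least 3 would contribute at least 6. *)
  have := @opening_excess a [:: a; b; b'] av Na.
  case: (andP lab) (andP lab') => ab _ [ab' _].
  rewrite /= !inE negb_or ab ab' bb' => /(_ isT).
  have sub : {subset [:: a; b; b'] <= comp_off e v a}.
    move=> w; rewrite !in_cons in_nil orbF; case/or3P=> /eqP->.
    - exact: comp_off_refl.
    - exact: opening_linked lab.
    - exact: opening_linked lab'.
  by move=> /(_ sub); rewrite !big_cons big_nil; lia.
(* Two seeing vertices are both adjacent to [v]. An edge between them gives a triangle, and a common
   neighbor must be [v], which is colored. *)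
- move=> a b _ _ /andP[ab lab]; rewrite !opening_cols.
  case: ifP => [av|]; last by rewrite eqxx.
  case: ifP => [bv|]; last by rewrite eqxx orbT.
  case/orP: lab => [eab|/existsP[y /and3P[cy ya yb]]].
    by case: (no_triangle forest_e eab bv); rewrite sym_e.
  rewrite sym_e in av; rewrite sym_e in bv.
  have yv := common_nbr_uniq forest_e ab ya yb av bv.
  by move: cy; rewrite yv recolorE eqxx.
- move=> s r ds dr sr; rewrite opening_cols; case: ifP => [sv _|]; last by rewrite eqxx.
  exact: opening_repairable.
Qed.

End Opening.

(** * Forests with at most 13 vertices *)

Theorem theorem5p5 (T : finType) (e : rel T) :
  forest e -> #|T| <= 13 -> game_chromatic_le e 3.
Proof.
move=> forest_e le13; exists 3 => //; rewrite /alice_wins.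
set c0 := [ffun _ => None].
(* The empty coloring is full exactly when there are no vertices; otherwise some vertex starts the
   search for a centroid. *)
have [fc|nfc] := boolP (full c0); first exact: AW_full.
move: (nfc); rewrite negb_forall => /existsP[v0 _].
have [v half] := centroid forest_e v0.
have c0v : c0 v = None by rewrite ffunE.
apply: AW_alice => //.
  by apply: not_bob_won => a _; rewrite cols_blank cards0.
exists v, ord0; split; first by rewrite legalE c0v eqxx cols_blank inE.
apply: secure_alice_wins => //; apply: opening_secure => // a av.
(* Twice the component size is at most 13, so the size is at most 6. *)
by have := half a av; lia.
Qed.
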